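(* Let $A,B\subset\mathbb R^n$ be nonempty closed sets and let $x^*\in A\cap B$. Suppose that $B$ intersects $A$ separably at $x^*$ with exponent $\omega\in[0,2)$ and constant $\gamma>0$, and that $B$ is $\omega/2$-H\''older regular at $x^*$ with respect to $A$ with constant $c<\frac{\gamma}{2}$. Then there exists a neighborhood $V$ of $x^*$ such that every sequence of alternating projections between $A$ and $B$ which enters $V$ converges to a point $b^*\in A\cap B$.
   Context: Notation: $\|\cdot\|$ and $\langle\cdot,\cdot\rangle$ are the Euclidean norm and scalar product, $\mathcal B(x,r)$ is the closed Euclidean ball, $d_S(x)=\min\{\|x-s\|:s\in S\}$, and $P_S(x)=\{s\in S:\|x-s\|=d_S(x)\}$ is the (set-valued) projection onto a nonempty closed set $S$. Write $P_A(a)^{-1}=\{b: a\in P_A(b)\}$ for $a\in A$. A sequence of alternating projections between $A$ and $B$ consists of $a_k\in A$, $b_k\in B$ with $b_k\in P_B(a_k)$, $a_{k+1}\in P_A(b_k)$ for $k\in\mathbb N$. It enters $V$ if some $a_k$ or some $b_k$ lies in $V$. It converges to $b^*$ if $a_k\to b^*$ and $b_k\to b^*$. A building block $b\to a^+\to b^+$ is a consecutive triple of such a sequence: $b\in P_B(a)$ for some $a\in A$, $a^+\in P_A(b)$, $b^+\in P_B(a^+)$. Separable intersection: $B$ intersects $A$ separably at $x^*\in A\cap B$ with exponent $\omega\in[0,2)$ and constant $\gamma>0$ if there is a neighborhood $U$ of $x^*$ such that every building block $b\to a^+\to b^+$ in $U$ (i.e. $b,a^+,b^+\in U$) satisfies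 $$\langle b-a^+,b^+-a^+\rangle\le\left(1-\gamma\|b^+-a^+\|^\omega\right)\|b-a^+\|\,\|b^+-a^+\|.$$ H\''older regularity: for $\sigma\in[0,1)$, $B$ is $\sigma$-H\''older regular with respect to $A$ at $b^*\in A\cap B$ with constant $c>0$ if there is a neighborhood $U$ of $b^*$ such that for every $a^+\in A\cap U$ and every $b^+\in P_B(a^+)\cap U$, with $r=\|a^+-b^+\|$, $$\mathcal B(a^+,(1+c)r)\cap\{b\in P_A(a^+)^{-1}:\langle a^+-b^+,b-b^+\rangle>\sqrt c\,r^{\sigma+1}\|b-b^+\|\}\cap B=\emptyset.$$ *)

(* Defs.v *)
From HB Require Import structures.
From mathcomp Require Import all_boot all_order all_algebra.
From mathcomp Require Import all_classical all_reals all_analysis.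
Set Implicit Arguments.
Unset Strict Implicit.
Unset Printing Implicit Defensive.
Import Order.TTheory GRing.Theory Num.Theory.
Import numFieldNormedType.Exports.
Local Open Scope classical_set_scope.
Local Open Scope ring_scope.

Definition dot (R : realType) (n : nat) (x y : 'rV[R]_n) : R :=
  \sum_(i < n) x 0 i * y 0 i.

(* The library norm `|x| on 'rV[R]_n is the sup norm; its topology (nbhs,
   closed, -->) is the Euclidean one, but lengths and projections must be
   taken with the Euclidean norm. *)
Definition enorm (R : realType) (n : nat) (x : 'rV[R]_n) : R :=
  Num.sqrt (dot x x).

Definition ecball (R : realType) (n : nat) (x : 'rV[R]_n) (r : R)
  : set 'rV[R]_n := [set y | enorm (y - x) <= r].

(* The infimum is attained whenever S is nonempty and closed. *)
Definition set_dist (R : realType) (n : nat) (S : set 'rV[R]_n) (x : 'rV[R]_n)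
  : R := inf [set enorm (x - s) | s in S].

Definition metric_proj (R : realType) (n : nat) (S : set 'rV[R]_n) (x : 'rV[R]_n)
  : set 'rV[R]_n := [set s | S s /\ enorm (x - s) = set_dist S x].

Definition metric_proj_inv (R : realType) (n : nat) (S : set 'rV[R]_n)
    (a : 'rV[R]_n) : set 'rV[R]_n := [set b | metric_proj S b a].

Definition alternating_projections (R : realType) (n : nat)
    (A B : set 'rV[R]_n) (a b : nat -> 'rV[R]_n) : Prop :=
  forall k : nat,
    [/\ A (a k), B (b k), metric_proj B (a k) (b k) & metric_proj A (b k) (a k.+1)].

Definition enters (R : realType) (n : nat) (V : set 'rV[R]_n)
    (a b : nat -> 'rV[R]_n) : Prop :=
  exists k : nat, V (a k) \/ V (b k).

Definition building_block (R : realType) (n : nat) (A B : set 'rV[R]_n)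
    (b a' b' : 'rV[R]_n) : Prop :=
  [/\ exists2 a, A a & metric_proj B a b, metric_proj A b a' & metric_proj B a' b'].

Definition intersects_separably (R : realType) (n : nat)
    (A B : set 'rV[R]_n) (x : 'rV[R]_n) (omega gamma : R) : Prop :=
  exists2 U : set 'rV[R]_n, nbhs x U &
    forall b a' b' : 'rV[R]_n, building_block A B b a' b' ->
      U b -> U a' -> U b' ->
      dot (b - a') (b' - a') <=
        (1 - gamma * enorm (b' - a') `^ omega)
          * enorm (b - a') * enorm (b' - a').

Definition holder_regular (R : realType) (n : nat)
    (A B : set 'rV[R]_n) (x : 'rV[R]_n) (sigma c : R) : Prop :=
  exists2 U : set 'rV[R]_n, nbhs x U &
    forall a' b' : 'rV[R]_n, (A `&` U) a' -> (metric_proj B a' `&` U) b' ->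
      let r := enorm (a' - b') in
      ecball a' ((1 + c) * r)
        `&` [set b | metric_proj_inv A a' b /\
               dot (a' - b') (b - b')
                 > Num.sqrt c * r `^ (sigma + 1) * enorm (b - b')]
        `&` B = set0.

(* Main.v *)
Require Import Defs.
From HB Require Import structures.
From mathcomp Require Import all_boot all_order all_algebra.
From mathcomp Require Import all_classical all_reals all_analysis.
From mathcomp Require Import ring lra.
Set Implicit Arguments.
Unset Strict Implicit.
Unset Printing Implicit Defensive.
Import Order.TTheory GRing.Theory Num.Theory.
Import numFieldNormedType.Exports.
Local Open Scope classical_set_scope.
Local Open Scope ring_scope.

(** Write [b, a, b'] for a building block, [p = |b - a|], [r = |b' - a|],
    [e = |b - b'|], and put [s = 1 + omega/2], [t = 2 - s = 1 - omega/2].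

    Separability is an angle condition. By the law of cosines it forces the
    side [e] opposite to that angle to be long: [K r^s <= e] with
    [K = sqrt (2 gamma)] (lemma [separable_gap]). Hoelder regularity bounds the
    scalar product of [a - b'] and [b - b'] by [sqrt c r^s e] as long as [b] is
    not much further from [a] than [b'] is; by the previous inequality this is
    at most [sqrt c / K * e^2], and [c < gamma / 2] says exactly that twice
    this coefficient is below 1. The law of cosines at [b'] then yields the
    three-point inequality [r^2 + l e^2 <= p^2] for some [l > 0]
    ([three_point]). If instead [b] is far from [a], so that [p > (1 + c) r],
    the triangle inequality [e <= p + r] is enough.

    From there the argument is of Kurdyka-Lojasiewicz type. The residuals
    [r_k] are nonincreasing, and the two inequalities together, through the
    concave function [r^t], give
    [2 e_{k+1} <= e_k + C (r_k^t - r_{k+1}^t)] ([kl_step]). Hence the energy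
    [E_k = e_k + C r_k^t] drops by at least the next step length [e_{k+1}]
    ([energy_drop]). This does two things at once. While the blocks stay
    in the neighborhood where both hypotheses hold, the distance to [x^*] plus
    the energy does not increase, so iterates that start close enough to [x^*]
    never leave it ([trapped]); and the [b_k] have finite length, hence
    converge ([lyapunov_cvg]). The drops of a convergent energy tend to 0, so
    do [e_k] and, by [K r_k^s <= e_k], the residuals [r_k]; thus [a_k] has the
    same limit, which lies in both closed sets ([trapped_cvg]). *)

(** * Euclidean geometry of row vectors *)

Section Euclidean.
Variables (R : realType) (n : nat).
Implicit Types (x y z : 'rV[R]_n) (S U : set 'rV[R]_n).

Lemma dot_ge0 x : 0 <= dot x x.
Proof. by apply: sumr_ge0 => i _; rewrite -expr2 sqr_ge0. Qed.

Lemma enorm_ge0 x : 0 <= enorm x.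
Proof. exact: sqrtr_ge0. Qed.

Lemma enorm_sqr x : enorm x ^+ 2 = dot x x.
Proof. by rewrite sqr_sqrtr// dot_ge0. Qed.

Lemma dot_scaleB (s t : R) x y :
  dot (s *: x - t *: y) (s *: x - t *: y) =
  s ^+ 2 * dot x x + t ^+ 2 * dot y y - 2 * (s * t) * dot x y.
Proof.
rewrite /dot !mulr_sumr -sumrN -!big_split; apply: eq_bigr => i _.
by rewrite !mxE /=; ring.
Qed.

Lemma enormB_sqr x y :
  enorm (x - y) ^+ 2 = enorm x ^+ 2 + enorm y ^+ 2 - 2 * dot x y.
Proof.
rewrite !enorm_sqr; have := dot_scaleB 1 1 x y.
by rewrite !scale1r => ->; ring.
Qed.

Lemma enormN x : enorm (- x) = enorm x.
Proof.
by congr Num.sqrt; apply: eq_bigr => i _; rewrite !mxE mulrNN.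
Qed.

Lemma enormC x y : enorm (x - y) = enorm (y - x).
Proof. by rewrite -enormN opprB. Qed.

Lemma dotNr x y : dot x (- y) = - dot x y.
Proof. by rewrite /dot -sumrN; apply: eq_bigr => i _; rewrite mxE mulrN. Qed.

Lemma coord_le_enorm x i : `|x 0 i| <= enorm x.
Proof.
rewrite -sqrtr_sqr ler_sqrt ?dot_ge0// /dot (bigD1 i)//= expr2 lerDl.
by apply: sumr_ge0 => j _; rewrite -expr2 sqr_ge0.
Qed.

Lemma enorm_eq0 x : enorm x = 0 -> x = 0.
Proof.
move=> x0; apply/rowP => i; rewrite mxE; apply/normr0_eq0/le_anti.
by rewrite normr_ge0 andbT -x0 coord_le_enorm.
Qed.

(** Cauchy-Schwarz, by expanding the square of [|y| x - |x| y]. *)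
Lemma dot_le_enormM x y : dot x y <= enorm x * enorm y.
Proof.
have d0 z : dot 0 z = 0 by apply: big1 => i _; rewrite mxE mul0r.
have d0' z : dot z 0 = 0 by apply: big1 => i _; rewrite mxE mulr0.
have [/enorm_eq0->|x0] := eqVneq (enorm x) 0.
  by rewrite d0 mulr_ge0 ?enorm_ge0.
have [/enorm_eq0->|y0] := eqVneq (enorm y) 0.
  by rewrite d0' mulr_ge0 ?enorm_ge0.
have xy0 : 0 < enorm x * enorm y by rewrite mulr_gt0// lt_def enorm_ge0 ?x0 ?y0.
have := dot_ge0 (enorm y *: x - enorm x *: y).
rewrite dot_scaleB -!enorm_sqr => h; rewrite -subr_ge0 -(pmulr_rge0 _ xy0).
by move: h; nra.
Qed.

Lemma enormB_triangle x y z : enorm (x - z) <= enorm (x - y) + enorm (y - z).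
Proof.
rewrite -(ler_pXn2r (ltn0Sn 1)) ?nnegrE ?addr_ge0 ?enorm_ge0//.
have -> : x - z = (x - y) - (z - y) by rewrite opprB addrA subrK.
rewrite enormB_sqr (enormC y z) sqrrD.
have := dot_le_enormM (x - y) (- (z - y)); rewrite dotNr enormN.
by lra.
Qed.

Lemma norm_le_enorm x : `|x| <= enorm x.
Proof.
rewrite [leLHS]/Num.norm /= mx_normrE; apply: bigmax_le => [|[i j] _ /=].
  exact: enorm_ge0.
by rewrite (ord1 i) coord_le_enorm.
Qed.

Lemma enorm_le_norm x : enorm x <= n.+1%:R * `|x|.
Proof.
rewrite -(ler_pXn2r (ltn0Sn 1)) ?nnegrE ?mulr_ge0 ?enorm_ge0//.
rewrite enorm_sqr exprMn.
apply: (@le_trans _ _ (\sum_(i < n) `|x| ^+ 2)).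
  apply: ler_sum => i _; rewrite -expr2 -(real_normK (num_real (x 0 i))).
  rewrite ler_pXn2r ?nnegrE//.
  rewrite [leRHS]/Num.norm /= mx_normrE.
  exact: (le_bigmax _ (fun ij => `|x ij.1 ij.2|) (0, i)).
rewrite sumr_const card_ord -[leLHS]mulr_natl ler_wpM2r ?sqr_ge0//.
by rewrite -natrX ler_nat (leq_trans (leqnSn n))// -mulnn leq_pmulr.
Qed.

(** Lengths are Euclidean while the topology comes from the sup norm; the
    equivalence of the two norms lets neighborhoods be taken as Euclidean
    balls. *)
Lemma nbhs_enormP x U :
  nbhs x U <-> exists2 d : R, 0 < d & forall y, enorm (y - x) < d -> U y.
Proof.
split=> [/nbhs_ballP[d /= d0 dU]|[d d0 dU]].
  exists d => // y yd; apply: dU; rewrite -ball_normE /ball_ /= distrC.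
  exact: le_lt_trans (norm_le_enorm _) yd.
apply/nbhs_ballP; exists (d / n.+1%:R) => /=; first by rewrite divr_gt0.
move=> y; rewrite -ball_normE /ball_ /= distrC => xy; apply: dU.
by rewrite (le_lt_trans (enorm_le_norm _))// mulrC -ltr_pdivlMr.
Qed.

Lemma metric_proj_le S x s t : metric_proj S x s -> S t ->
  enorm (x - s) <= enorm (x - t).
Proof.
move=> [_ ->] St; apply: ge_inf; last by exists t.
by exists 0 => _ [u _ <-]; exact: enorm_ge0.
Qed.

(** A point of [S] at distance at most [d] from [y] keeps the projections of
    [y] within [d] of [y]; this is what controls a whole building block by its
    first point. *)
Lemma metric_proj_near S x y z (d : R) : S x ->
  metric_proj S y z -> enorm (y - x) <= d -> enorm (z - x) <= 2 * d.
Proof.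
move=> Sx yz yd; rewrite (le_trans (enormB_triangle z y x))//.
by have := metric_proj_le yz Sx; rewrite (enormC z y); lra.
Qed.

End Euclidean.

(** * The scalar recursion *)

Section Scalar.
Variable R : realType.

(** Young's inequality for [x^s y^t] with the conjugate exponents [2/s] and
    [2/t]. Divided by [x^s], it bounds below the decrease of [z^t], a concave
    function of [z^2], by its derivative times the decrease of [z^2]. *)
Lemma powR_descent (s t x y : R) : 0 < s -> 0 < t -> s + t = 2 ->
  0 <= x -> 0 <= y ->
  t / 2 * (x ^+ 2 - y ^+ 2) <= x `^ s * (x `^ t - y `^ t).
Proof.
move=> s0 t0 st x0 y0.
have pp (z u : R) : 0 < u -> 0 <= z -> (z `^ u) `^ (2 / u) = z ^+ 2.
  by move=> u0 z0; rewrite -powRrM mulrC divfK ?gt_eqF// powR_mulrn.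
have e1 : x `^ s * x `^ t = x ^+ 2.
  by rewrite -powRD st ?powR_mulrn// pnatr_eq0.
have := @conjugate_powR R (x `^ s) (y `^ t) (2 / s) (2 / t).
rewrite !pp// !powR_ge0 !divr_gt0// !invf_div -mulrDl st divff ?pnatr_eq0//.
move=> /(_ isT isT isT isT erefl); rewrite (mulrBr (x `^ s)) e1.
have -> : s = 2 - t by rewrite -st addrK.
by lra.
Qed.

(** The descent [r^2 - r'^2] controls [e'^2], and multiplying the decrease of
    [r^t] by [r^s <= e / K] recovers that descent; so [e'^2] is at most [e]
    times a telescoping term, and the inequality between the geometric and the
    arithmetic mean makes this linear. *)
Lemma kl_step (K l s t e e' r r' : R) :
  0 < K -> 0 < l -> 0 < s -> 0 < t -> s + t = 2 ->
  0 <= e -> 0 <= e' -> 0 <= r' -> r' <= r ->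
  K * r `^ s <= e -> l * e' ^+ 2 <= r ^+ 2 - r' ^+ 2 ->
  2 * e' <= e + 2 / (K * l * t) * (r `^ t - r' `^ t).
Proof.
move=> K0 l0 s0 t0 st e0 e'0 r'0 rr Kr le.
have r0 := le_trans r'0 rr.
have := powR_descent s0 t0 st r0 r'0.
set D := r `^ t - r' `^ t; set C := 2 / (K * l * t) => hD.
have D0 : 0 <= D.
  by rewrite subr_ge0; apply: ge0_ler_powR; rewrite ?nnegrE// ltW.
have C0 : 0 < C by rewrite divr_gt0// !mulr_gt0.
have CE : C * (K * l * t) = 2 by rewrite divfK// !mulf_neq0// gt_eqF.
have ee : e' ^+ 2 <= e * (C * D).
  rewrite -(ler_pM2l (_ : 0 < K * l * t)) ?mulr_gt0//.
  have -> : K * l * t * (e * (C * D)) = 2 * e * D.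
    by rewrite -CE; ring.
  apply: (@le_trans _ _ (K * t * (r ^+ 2 - r' ^+ 2))).
    have := ler_wpM2l (ltW (mulr_gt0 K0 t0)) le; lra.
  apply: (@le_trans _ _ (2 * K * (r `^ s * D))).
    have := ler_wpM2l (ltW K0) hD; lra.
  have := ler_wpM2r D0 Kr; lra.
have CD0 : 0 <= C * D by exact: mulr_ge0 (ltW C0) D0.
rewrite -(ler_pXn2r (ltn0Sn 1)) ?nnegrE ?(addr_ge0 e0 CD0) ?mulr_ge0//.
have := sqr_ge0 (e - C * D); lra.
Qed.

End Scalar.

(** * Estimates on one building block *)

Section ThreePoint.
Variables (R : realType) (n : nat) (omega gamma c : R).
Hypotheses (omega_ge0 : 0 <= omega) (gamma_gt0 : 0 < gamma) (c_gt0 : 0 < c).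
Variables b a b' : 'rV[R]_n.
Let r := enorm (b' - a).
Let p := enorm (b - a).
Let e := enorm (b - b').
Hypothesis rp : r <= p.
Hypothesis sep : dot (b - a) (b' - a) <= (1 - gamma * r `^ omega) * p * r.

Let r0 : 0 <= r := enorm_ge0 _.
Let p0 : 0 <= p := enorm_ge0 _.
Let e0 : 0 <= e := enorm_ge0 _.

(** Law of cosines at [a]: the angle condition gives
    [e^2 >= (p - r)^2 + 2 gamma r^omega p r], and [p >= r]. *)
Lemma separable_gap : Num.sqrt (2 * gamma) * r `^ (omega / 2 + 1) <= e.
Proof.
rewrite -(ler_pXn2r (ltn0Sn 1)) ?nnegrE ?mulr_ge0 ?sqrtr_ge0 ?powR_ge0//.
rewrite exprMn sqr_sqrtr; last by rewrite mulr_ge0// ltW.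
have -> : (r `^ (omega / 2 + 1)) ^+ 2 = r `^ omega * r ^+ 2.
  rewrite -!powR_mulrn ?powR_ge0// -powRrM -powRD; last first.
    by apply/implyP; rewrite gt_eqF// ltr_wpDl.
  by congr (_ `^ _); field.
have := enormB_sqr (b - a) (b' - a); rewrite -/p -/r.
have -> : b - a - (b' - a) = b - b' by rewrite opprB addrA subrK.
rewrite -/e => ->.
have h1 : 0 <= gamma * r `^ omega * r * (p - r).
  by rewrite !mulr_ge0 ?powR_ge0 ?subr_ge0// ltW.
have := sqr_ge0 (p - r).
move: sep h1; set w := r `^ omega; set d := dot _ _; lra.
Qed.

(** The two upper bounds on [l] serve the two cases: the first one when
    [p > (1 + c) r], where regularity says nothing, and the second one in the
    range of the regularity hypothesis, where [separable_gap] turns the factor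
    [r^s] into a multiple of [e]. *)
Lemma three_point (l : R) : 0 <= l -> l * (2 + c) <= c ->
  l <= 1 - 2 * Num.sqrt c / Num.sqrt (2 * gamma) ->
  (p <= (1 + c) * r ->
     dot (a - b') (b - b') <= Num.sqrt c * r `^ (omega / 2 + 1) * e) ->
  r ^+ 2 + l * e ^+ 2 <= p ^+ 2.
Proof.
move=> l0 lc lq hold.
have [far|near] := ltP ((1 + c) * r) p.
  have epr : e <= p + r.
    by rewrite /e (le_trans (enormB_triangle b a b'))// lerD2l /r enormC.
  have h1 : l * (p + r) <= p - r.
    rewrite -(ler_pM2l (_ : 0 < 2 + c)); last by rewrite ltr_wpDl.
    have := ler_wpM2r (addr_ge0 p0 r0) lc; lra.
  have h2 : e ^+ 2 <= (p + r) ^+ 2 by rewrite ler_pXn2r ?nnegrE ?addr_ge0.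
  have := ler_wpM2l l0 h2; have := ler_wpM2r (addr_ge0 p0 r0) h1; lra.
have g0 : 0 < Num.sqrt (2 * gamma) by rewrite sqrtr_gt0 mulr_gt0.
have := enormB_sqr (b - b') (a - b').
have -> : b - b' - (a - b') = b - a by rewrite opprB addrA subrK.
rewrite -/p -/e (enormC a) -/r => ->.
have dC : dot (b - b') (a - b') = dot (a - b') (b - b').
  by apply: eq_bigr => i _; rewrite mulrC.
rewrite dC; have hd := hold near.
set q := 2 * Num.sqrt c / Num.sqrt (2 * gamma) in lq.
have hq : 2 * dot (a - b') (b - b') <= q * e ^+ 2.
  apply: (@le_trans _ _ (q * (Num.sqrt (2 * gamma) * r `^ (omega / 2 + 1)) * e)).
    have -> : q * (Num.sqrt (2 * gamma) * r `^ (omega / 2 + 1)) =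
      2 * Num.sqrt c * r `^ (omega / 2 + 1).
      by rewrite mulrA /q divfK// gt_eqF.
    by move: hd; lra.
  rewrite expr2 [leRHS]mulrA ler_wpM2r// ler_wpM2l ?separable_gap//.
  by rewrite divr_ge0 ?mulr_ge0 ?sqrtr_ge0.
have := ler_wpM2r (sqr_ge0 e) lq; lra.
Qed.

End ThreePoint.

(** * Trapping and convergence *)

Section Convergence.
Variables (R : realType) (n : nat).

(** The increments are dominated by those of a monotone bounded sequence, so
    they telescope to a Cauchy estimate. *)
Lemma lyapunov_cvg (u : nat -> 'rV[R]_n) (L : nat -> R) :
  (forall k, 0 <= L k) ->
  (forall k, enorm (u k - u k.+1) <= L k - L k.+1) ->
  exists l : 'rV[R]_n, u @ \oo --> l.
Proof.
move=> L0 uL.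
have Lni : nonincreasing_seq L.
  apply/nonincreasing_seqP => k.
  by rewrite -subr_ge0 (le_trans (enorm_ge0 _) (uL k)).
have Lcvg : cvgn L.
  by apply: nonincreasing_is_cvgn => //; exists 0 => _ [k _ <-].
have Linf k : limn L <= L k by exact: nonincreasing_cvgn_ge.
have tele N k : enorm (u N - u (N + k)%N) <= L N - L (N + k)%N.
  elim: k => [|k ih].
    rewrite addn0 !subrr /enorm /dot big1 ?sqrtr0// => i _.
    by rewrite mxE mul0r.
  rewrite addnS (le_trans (enormB_triangle _ (u (N + k)%N) _))//.
  have := uL (N + k)%N; lra.
have : cauchy (fmap u (nbhs \oo)).
  apply: cauchy_exP => eps eps0.
  have /cvgrPdist_lt/(_ eps eps0)[N _ hN] := Lcvg.
  exists (u N), N => // m /= Nm; rewrite -ball_normE /ball_ /=.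
  apply: (le_lt_trans (norm_le_enorm _)); rewrite -(subnKC Nm).
  apply: (le_lt_trans (tele _ _)).
  have := hN _ (leqnn N); rewrite distrC ger0_norm ?subr_ge0//.
  by have := Linf (N + (m - N))%N; rewrite /=; lra.
by move=> /cauchy_cvg/cvg_ex.
Qed.

End Convergence.

Section TrappedSequence.
Variables (R : realType) (K l s t eta : R).
Hypotheses (K0 : 0 < K) (l0 : 0 < l).
Hypotheses (s0 : 0 < s) (t0 : 0 < t) (st2 : s + t = 2).

Definition kl_const : R := 2 / (K * l * t).

Lemma kl_const_gt0 : 0 < kl_const.
Proof. by rewrite divr_gt0// !mulr_gt0. Qed.

Definition energy (e r : nat -> R) k : R := e k + kl_const * r k `^ t.

(* [D], [e] and [r] stand for the distance of [b_k] to the reference point,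
   the step lengths and the residuals; the estimates are only available at
   indices where [D] is below [eta]. *)
Variables D e r : nat -> R.
Hypotheses (e_ge0 : forall k, 0 <= e k) (r_ge0 : forall k, 0 <= r k).
Hypothesis r_ni : forall k, r k.+1 <= r k.
Hypothesis gap : forall k, D k < eta -> K * r k `^ s <= e k.
Hypothesis descent : forall k, D k.+1 < eta ->
  l * e k.+1 ^+ 2 <= r k ^+ 2 - r k.+1 ^+ 2.

Lemma energy_ge0 k : 0 <= energy e r k.
Proof.
exact: addr_ge0 (e_ge0 k) (mulr_ge0 (ltW kl_const_gt0) (powR_ge0 _ _)).
Qed.

Lemma energy_drop k : D k < eta -> D k.+1 < eta ->
  e k.+1 <= energy e r k - energy e r k.+1.
Proof.
move=> /gap Kr /descent le.
have := kl_step K0 l0 s0 t0 st2 (e_ge0 k) (e_ge0 k.+1) (r_ge0 k.+1) (r_ni k) Kr le.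
rewrite /energy -/kl_const mulrBr.
by move: (kl_const * r k `^ t) (kl_const * r k.+1 `^ t) => u v; lra.
Qed.

Hypothesis D_step : forall k, D k.+2 <= D k.+1 + e k.+1.
Hypotheses (D0 : D 0%N < eta) (D1 : D 1%N + energy e r 0 < eta).

(** The sum [D k.+1 + energy e r k] is nonincreasing as long as the estimates
    hold, and it dominates the next distance: they hold forever. *)
Lemma trapped k : D k < eta.
Proof.
suff: D k < eta /\ D k.+1 + energy e r k < eta by case.
elim: k => [//|k [Dk DEk]].
have Dk1 : D k.+1 < eta by rewrite (le_lt_trans _ DEk)// lerDl energy_ge0.
split=> //; rewrite (le_lt_trans _ DEk)//.
have := energy_drop Dk Dk1; have := D_step k.
by move: (energy e r k) (energy e r k.+1) => u v; lra.
Qed.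

Lemma step_le_energy_drop k : e k.+1 <= energy e r k - energy e r k.+1.
Proof. exact: energy_drop (trapped k) (trapped k.+1). Qed.

Lemma energy_drop_cvg0 : (fun k => energy e r k - energy e r k.+1) @ \oo --> 0.
Proof.
have Eni : nonincreasing_seq (energy e r).
  apply/nonincreasing_seqP => k; rewrite -subr_ge0.
  exact: le_trans (e_ge0 k.+1) (step_le_energy_drop k).
have Ecvg : cvgn (energy e r).
  apply: nonincreasing_is_cvgn => //.
  by exists 0 => _ [k _ <-]; exact: energy_ge0.
rewrite -(subrr (limn (energy e r))); apply: cvgB => //.
by rewrite (cvg_shiftS (energy e r)).
Qed.

Lemma trapped_gap_cvg0 : r @ \oo --> 0.
Proof.
rewrite -cvg_shiftS; apply/cvgr0Pnorm_lt => eps eps0.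
have h0 : 0 < K * eps `^ s by rewrite mulr_gt0// powR_gt0.
move/cvgr0Pnorm_lt/(_ _ h0): energy_drop_cvg0; apply: filterS => k.
rewrite ger0_norm ?(le_trans (e_ge0 _) (step_le_energy_drop k))// => hk.
rewrite ger0_norm//= ltNge; apply/negP => er.
have : K * eps `^ s <= K * r k.+1 `^ s.
  rewrite ler_wpM2l ?(ltW K0)//; apply: ge0_ler_powR;
    by rewrite ?nnegrE ?(ltW s0) ?(ltW eps0).
rewrite leNgt (le_lt_trans (gap (trapped k.+1)))//.
exact: le_lt_trans (step_le_energy_drop k) hk.
Qed.

End TrappedSequence.

Section Trapping.
Variables (R : realType) (n : nat) (A B : set 'rV[R]_n) (x : 'rV[R]_n).
Hypotheses (A_closed : closed A) (B_closed : closed B) (Ax : A x) (Bx : B x).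
Variables (rho K l s t : R).
Hypotheses (rho0 : 0 < rho) (K0 : 0 < K) (l0 : 0 < l).
Hypotheses (s0 : 0 < s) (t0 : 0 < t) (st2 : s + t = 2).
Hypothesis block : forall b a b', building_block A B b a b' ->
  enorm (b - x) < rho -> enorm (a - x) < rho -> enorm (b' - x) < rho ->
  K * enorm (b' - a) `^ s <= enorm (b - b') /\
  enorm (b' - a) ^+ 2 + l * enorm (b - b') ^+ 2 <= enorm (b - a) ^+ 2.

(** A start within [d] of the reference point gives, by two projections, a
    next point within [4 d], a first step of length at most [5 d] and a first
    residual of at most [2 d]: the left-hand side bounds the initial distance
    plus energy. *)
Lemma small_radius :
  exists2 d : R, 0 < d & 9 * d + kl_const K l t * (2 * d) `^ t < rho / 4.
Proof.
have C0 := kl_const_gt0 K0 l0 t0; set C := kl_const K l t in C0 *.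
clearbody C.
pose y := (rho / (16 * C)) `^ t^-1.
have y0 : 0 < y by rewrite powR_gt0// divr_gt0// mulr_gt0.
pose d := Num.min (rho / 144) (y / 2).
have d0 : 0 < d by rewrite lt_min !divr_gt0.
exists d => //.
have d1 : d <= rho / 144 by rewrite ge_min lexx.
have d2 : 2 * d <= y.
  by rewrite mulrC -ler_pdivlMr// ge_min lexx orbT.
have h : C * (2 * d) `^ t <= rho / 16.
  apply: (@le_trans _ _ (C * y `^ t)).
    rewrite ler_wpM2l ?(ltW C0)//; apply: ge0_ler_powR => //; first exact: ltW.
      by rewrite nnegrE mulr_ge0// ltW.
    by rewrite nnegrE ltW.
  rewrite /y -powRrM mulVf ?gt_eqF// powRr1; last first.
    by rewrite ltW// divr_gt0// mulr_gt0.
  suff -> : C * (rho / (16 * C)) = rho / 16 by [].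
  by field; rewrite gt_eqF.
by move: rho0 h d1; clearbody d; move: (C * _) => w; lra.
Qed.

Variables (a b : nat -> 'rV[R]_n) (d : R).
Hypothesis ap : alternating_projections A B a b.
Hypotheses (d0 : 0 < d)
  (d_small : 9 * d + kl_const K l t * (2 * d) `^ t < rho / 4).
Hypothesis start : enorm (b 0%N - x) <= d.

Lemma residual_le_proj k :
  enorm (b k.+1 - a k.+1) <= enorm (b k - a k.+1).
Proof.
have [_ Bk _ _] := ap k; have [_ _ bk _] := ap k.+1.
by rewrite !(enormC _ (a _)); exact: metric_proj_le bk Bk.
Qed.

Lemma proj_le_residual k :
  enorm (b k.+1 - a k.+2) <= enorm (b k.+1 - a k.+1).
Proof. by have [Ak _ _ ak] := ap k.+1; exact: metric_proj_le ak Ak. Qed.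

(** Each projection at most doubles the distance to [x], so a block whose first
    point is within [rho / 4] stays within [rho]. *)
Lemma near_block k : enorm (b k - x) < rho / 4 ->
  K * enorm (b k.+1 - a k.+1) `^ s <= enorm (b k - b k.+1) /\
  enorm (b k.+1 - a k.+1) ^+ 2 + l * enorm (b k - b k.+1) ^+ 2
    <= enorm (b k - a k.+1) ^+ 2.
Proof.
have [Ak Bk bk ak] := ap k; have [Ak' Bk' bk' ak'] := ap k.+1.
move=> bx; have ha := metric_proj_near Ax ak (lexx _).
have hb := metric_proj_near Bx bk' ha.
apply: block; first by split => //; exists (a k).
- by move: rho0 bx; lra.
- by move: rho0 bx ha; lra.
- by move: rho0 bx hb; lra.
Qed.

Lemma start_small :
  enorm (b 1%N - x) +
    energy K l t (fun k => enorm (b k - b k.+1))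
      (fun k => enorm (b k.+1 - a k.+1)) 0 < rho / 4.
Proof.
have [_ _ _ a1] := ap 0; have [_ _ b1 _] := ap 1%N.
have a1x := metric_proj_near Ax a1 start.
have b1x := metric_proj_near Bx b1 a1x.
have e1 : enorm (b 0%N - b 1%N) <= 5 * d.
  rewrite (le_trans (enormB_triangle _ x _))// (enormC x).
  by move: start b1x; lra.
have r1 : enorm (b 1%N - a 1%N) <= 2 * d.
  by rewrite enormC (le_trans (metric_proj_le b1 Bx)).
have rt : kl_const K l t * enorm (b 1%N - a 1%N) `^ t
    <= kl_const K l t * (2 * d) `^ t.
  rewrite ler_wpM2l ?(ltW (kl_const_gt0 K0 l0 t0))//.
  apply: ge0_ler_powR; rewrite ?nnegrE ?(ltW t0) ?enorm_ge0//.
  by rewrite mulr_ge0// ltW.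
move: rt e1 b1x d_small; rewrite /energy.
by move: (_ * _ `^ _) (_ * (2 * d) `^ _) => u v; lra.
Qed.

Lemma trapped_cvg :
  exists z : 'rV[R]_n, [/\ (A `&` B) z, a @ \oo --> z & b @ \oo --> z].
Proof.
pose D k := enorm (b k - x).
pose e k := enorm (b k - b k.+1).
pose r k := enorm (b k.+1 - a k.+1).
have e_ge0 k : 0 <= e k by exact: enorm_ge0.
have r_ge0 k : 0 <= r k by exact: enorm_ge0.
have r_ni k : r k.+1 <= r k.
  exact: le_trans (residual_le_proj _) (proj_le_residual k).
have gap k : D k < rho / 4 -> K * r k `^ s <= e k by case/near_block.
have descent k : D k.+1 < rho / 4 -> l * e k.+1 ^+ 2 <= r k ^+ 2 - r k.+1 ^+ 2.
  case/near_block => _ h; rewrite lerBrDl (le_trans h)//.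
  by rewrite ler_pXn2r ?nnegrE ?enorm_ge0 ?proj_le_residual.
have D_step k : D k.+2 <= D k.+1 + e k.+1.
  by rewrite addrC /e enormC; exact: enormB_triangle.
have D0 : D 0%N < rho / 4.
  apply: (le_lt_trans start); move: d_small d0.
  have := mulr_ge0 (ltW (kl_const_gt0 K0 l0 t0)) (powR_ge0 (2 * d) t).
  by move: (_ * _ `^ _) => u; lra.
have drop := step_le_energy_drop K0 l0 s0 t0 st2 e_ge0 r_ge0 r_ni gap descent
  D_step D0 start_small.
have r0 := trapped_gap_cvg0 K0 l0 s0 t0 st2 e_ge0 r_ge0 r_ni gap descent
  D_step D0 start_small.
have [z bz] : exists z : 'rV[R]_n, (fun k => b k.+1) @ \oo --> z.
  apply: (lyapunov_cvg _ drop) => k; exact: energy_ge0.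
have az : (fun k => a k.+1) @ \oo --> z.
  have -> : (fun k => a k.+1) = (fun k => b k.+1 - (b k.+1 - a k.+1)).
    by apply/funext => k; rewrite opprB addrC subrK.
  rewrite -[X in _ --> X]subr0; apply: cvgB => //.
  apply/cvgr0Pnorm_lt => eps eps0.
  move/cvgr0Pnorm_lt/(_ _ eps0): r0; apply: filterS => k.
  rewrite ger0_norm//; exact/le_lt_trans/norm_le_enorm.
have az' : a @ \oo --> z by rewrite -cvg_shiftS.
have bz' : b @ \oo --> z by rewrite -cvg_shiftS.
exists z; split=> //; split.
  by apply: (closed_cvg A A_closed _ z az'); near=> k; have [] := ap k.
by apply: (closed_cvg B B_closed _ z bz'); near=> k; have [] := ap k.
Unshelve. all: by end_near. Qed.

End Trapping.

(** * The theorem *)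

Theorem theorem1 (R : realType) (n : nat) (A B : set 'rV[R]_n)
    (A_neq0 : A !=set0) (B_neq0 : B !=set0)
    (A_closed : closed A) (B_closed : closed B)
    (xstar : 'rV[R]_n) (xstarAB : (A `&` B) xstar)
    (omega gamma c : R) (omega_ge0 : 0 <= omega) (omega_lt2 : omega < 2)
    (gamma_gt0 : 0 < gamma) (c_gt0 : 0 < c) (c_lt : c < gamma / 2)
    (sepAB : intersects_separably A B xstar omega gamma)
    (holdAB : holder_regular A B xstar (omega / 2) c) :
  exists2 V : set 'rV[R]_n, nbhs xstar V &
    forall a b : nat -> 'rV[R]_n,
      alternating_projections A B a b -> enters V a b ->
      exists bstar : 'rV[R]_n,
        [/\ (A `&` B) bstar, a @ \oo --> bstar & b @ \oo --> bstar].
Proof.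
have [Ax Bx] := xstarAB.
have [U1 /nbhs_enormP[d1 d10 dU1] sep] := sepAB.
have [U2 /nbhs_enormP[d2 d20 dU2] hold] := holdAB.
pose K := Num.sqrt (2 * gamma).
have K0 : 0 < K by rewrite sqrtr_gt0 mulr_gt0.
pose q := 2 * Num.sqrt c / K.
(* This is where [c < gamma / 2] enters. *)
have q1 : 0 < 1 - q.
  rewrite subr_gt0 ltr_pdivrMr// mul1r -(ltr_pXn2r (ltn0Sn 1)) ?nnegrE;
    rewrite ?mulr_ge0 ?sqrtr_ge0//.
  rewrite exprMn !sqr_sqrtr ?(ltW c_gt0)//; last by rewrite mulr_ge0// ltW.
  by move: c_lt; lra.
(* The largest constant allowed by both cases of [three_point]. *)
pose l := Num.min (c / (2 + c)) (1 - q).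
have c20 : 0 < 2 + c by rewrite ltr_wpDl.
have l0 : 0 < l by rewrite lt_min q1 divr_gt0.
have lc : l * (2 + c) <= c by rewrite -ler_pdivlMr// ge_min lexx.
have lq : l <= 1 - q by rewrite ge_min lexx orbT.
pose rho := Num.min d1 d2.
have rho0 : 0 < rho by rewrite lt_min d10.
have s0 : 0 < omega / 2 + 1 by rewrite ltr_wpDl ?divr_ge0.
have t0 : 0 < 1 - omega / 2 by move: omega_lt2; lra.
have st : (omega / 2 + 1) + (1 - omega / 2) = 2 by ring.
have block b a b' : building_block A B b a b' -> enorm (b - xstar) < rho ->
    enorm (a - xstar) < rho -> enorm (b' - xstar) < rho ->
  K * enorm (b' - a) `^ (omega / 2 + 1) <= enorm (b - b') /\
  enorm (b' - a) ^+ 2 + l * enorm (b - b') ^+ 2 <= enorm (b - a) ^+ 2.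
  move=> bb; rewrite !lt_min => /andP[b1 b2] /andP[a1 a2] /andP[b'1 b'2].
  have [[a0 Aa0 pb] pa pb'] := bb.
  have Bb : B b by case: pb.
  have Aa : A a by case: pa.
  have rp : enorm (b' - a) <= enorm (b - a).
    by rewrite !(enormC _ a); exact: metric_proj_le pb' Bb.
  have hsep := sep _ _ _ bb (dU1 _ b1) (dU1 _ a1) (dU1 _ b'1).
  split; first exact: separable_gap hsep.
  apply: (three_point omega_ge0 gamma_gt0 c_gt0 rp hsep (ltW l0) lc lq) => pr.
  rewrite leNgt; apply/negP => hd.
  have /= h := hold a b' (conj Aa (dU2 _ a2)) (conj pb' (dU2 _ b'2)).
  rewrite (enormC a) in h.
  suff : set0 b by [].
  by rewrite -h.
(* Half the radius leaves room for entering through some [a_k]: its projection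
   [b_k] is at most twice as far. *)
have [d d0 dsmall] := small_radius rho0 K0 l0 t0.
exists [set y | enorm (y - xstar) < d / 2].
  by apply/nbhs_enormP; exists (d / 2) => //; rewrite divr_gt0.
move=> a b ap [k hk].
have start : enorm (b k - xstar) <= d.
  have [_ _ bk _] := ap k.
  case: hk => /= hk; last by move: d0 hk; lra.
  by have := metric_proj_near Bx bk (ltW hk); lra.
have apk : alternating_projections A B (fun j => a (j + k)%N) (fun j => b (j + k)%N).
  by move=> j; exact: ap.
have [z [ABz az bz]] := trapped_cvg A_closed B_closed Ax Bx rho0 K0 l0 s0 t0 st
  block apk d0 dsmall start.
by exists z; split=> //; rewrite -(cvg_shiftn k).
Qed.
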